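(* Let $F=(F_n)_{n\ge 1}$ be a compatible family, and assume that $F$ is summable at cosine points. Then for every sufficiently large integer $n$, the value $a_F(n)$ is fixed by $G_n$; equivalently, $a_F(n)\in\mathbb{Q}$ for all sufficiently large $n$.
   Context: For $n\ge 2$ let $\omega_n=e^{2\pi i/n}$, $G_n=\mathrm{Gal}(\mathbb{Q}(\omega_n)/\mathbb{Q})$, and $\alpha_{k,n}=\cos(2\pi k/n)\in\mathbb{Q}(\omega_n)$ for $1\le k\le n-1$. A compatible family is a sequence $F=(F_n)_{n\ge 1}$ with $F_n\in\mathbb{Q}[x_1,\dots,x_n]$ and $F_n(x_1,\dots,x_n)=F_{n+1}(x_1,\dots,x_n,0)$ for all $n\ge 1$. For $n\ge 2$ its cosine-point evaluation is $a_F(n)=F_{n-1}(\alpha_{1,n},\dots,\alpha_{n-1,n})$. A compatible family $F$ is summable at cosine points if there exist an integer $N\ge 2$ and a rational function $R(n)\in\mathbb{Q}(n)$, defined at every integer $n\ge N$, such that $a_F(n)=R(n)$ for all integers $n\ge N$. *)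

(* Defs.v *)
From HB Require Import structures.
From mathcomp Require Import all_boot all_order all_algebra all_field.
From mathcomp Require Import complex reals trigo mpoly.
From mathcomp Require Import ring lra.

Set Implicit Arguments.
Unset Strict Implicit.
Unset Printing Implicit Defensive.

Import Order.TTheory GRing.Theory Num.Theory.
Local Open Scope ring_scope.
Local Open Scope complex_scope.

Section RootsOfUnity.

Variable R : realType.

Definition expi (t : R) : R[i] := cos t +i* sin t.

Definition omega (n : nat) : R[i] := expi (2 * pi / n%:R).

Lemma expi0 : expi 0 = 1.
Proof. by rewrite /expi cos0 sin0. Qed.

Lemma expiD (s t : R) : expi (s + t) = expi s * expi t.
Proof.
rewrite /expi cosD sinD; apply/eqP; rewrite eq_complex /=.
by rewrite eqxx /= addrC eqxx.
Qed.

Lemma expiX (t : R) k : expi t ^+ k = expi (k%:R * t).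
Proof.
elim: k => [|k IHk]; first by rewrite mul0r expi0.
by rewrite exprSr IHk -expiD mulrSr mulrDl mul1r.
Qed.

Lemma expi_neq1 (t : R) : 0 < t < 2 * pi -> expi t != 1.
Proof.
case/andP=> t_gt0 t_lt; apply/eqP=> /(congr1 (@complex.Re R)) /= cost1.
have s_gt0 : 0 < sin (t / 2) by apply: sin_gt0_pi; apply/andP; split; lra.
have defs : t = t / 2 + t / 2 by field.
have := cos2Dsin2 (t / 2); move: cost1; rewrite {1}defs cosD; nra.
Qed.

Lemma omega_prim n : (0 < n)%N -> n.-primitive_root (omega n).
Proof.
move=> n_gt0; have n0 : 0 < n%:R :> R by rewrite ltr0n.
have omegaX k : omega n ^+ k = expi (2 * pi * (k%:R / n%:R)).
  by rewrite expiX; congr expi; field; rewrite lt0r_neq0.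
have omegan1 : omega n ^+ n = 1.
  rewrite omegaX divff ?lt0r_neq0 // mulr1 /expi mulrC.
  by rewrite [pi * 2]mulr_natr cos2pi sin2pi.
apply/andP; split=> //; apply/forallP=> /= i; rewrite unity_rootE.
apply/eqP; case: (ltngtP i.+1 n) => [lt_in | | ->]; last by rewrite omegan1 eqxx.
  apply/negbTE; rewrite omegaX; apply: expi_neq1; apply/andP; split.
    by rewrite !mulr_gt0 ?pi_gt0 ?ltr0n ?invr_gt0.
  by rewrite gtr_pMr ?mulr_gt0 ?pi_gt0 // ltr_pdivrMr // mul1r ltr_nat.
by rewrite ltnNge ltn_ord.
Qed.

(* 'Phi_0 = 1 in the library, whereas omega 0 = omega 1 = 1 here (division by
   0 yields 0); taking maxn n 1 makes the definitions below total in n. *)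
Definition QPhi (n : nat) : {poly rat} := map_poly intr 'Phi_(maxn n 1).

Lemma omega_max n : omega (maxn n 1) = omega n.
Proof.
case: n => [|n]; last by rewrite (maxn_idPl _).
by rewrite /= -[LHS]expr1 (prim_expr_order (omega_prim _)) // /omega invr0 mulr0 expi0.
Qed.

Lemma map_QPhi (K : numFieldType) n :
  map_poly (ratr : rat -> K) (QPhi n) = map_poly intr 'Phi_(maxn n 1).
Proof.
by rewrite -map_poly_comp; apply: eq_map_poly => a /=; rewrite ratr_int.
Qed.

Lemma root_Cyclotomic (K : numFieldType) (z : K) n :
  n.-primitive_root z -> root (map_poly intr 'Phi_n) z.
Proof.
move=> prim_z; have n_gt0 := prim_order_gt0 prim_z.
have mapX d : (0 < d)%N ->
    'X^d - 1 = \prod_(e <- divisors d) map_poly intr 'Phi_e :> {poly K}.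
  move=> d_gt0; rewrite -rmorph_prod /= prod_Cyclotomic //.
  by rewrite rmorphB /= map_polyXn rmorph1.
have rootP s : root (\prod_(e <- s) map_poly intr 'Phi_e) z =
    has (fun e => root (map_poly intr 'Phi_e) z) s.
  elim: s => [|e s IHs]; first by rewrite big_nil rootC oner_eq0.
  by rewrite big_cons rootM IHs.
have : root ('X^n - 1) z by rewrite /root !hornerE prim_expr_order ?subrr.
rewrite mapX // rootP => /hasP[d]; rewrite -dvdn_divisors // => d_n /= dz0.
have d_gt0 := dvdn_gt0 n_gt0 d_n.
have : root ('X^d - 1) z.
  rewrite mapX // rootP; apply/hasP; exists d => //.
  by rewrite -dvdn_divisors.
rewrite /root !hornerE subr_eq0 -(prim_order_dvd prim_z) => n_d.
by have /eqP <- : d == n by rewrite eqn_dvd d_n.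
Qed.

Lemma QPhi_root n : root (map_poly ratr (QPhi n)) (omega n).
Proof.
rewrite map_QPhi -omega_max; apply/root_Cyclotomic/omega_prim.
by rewrite leq_max orbT.
Qed.

Lemma QPhi_neq0 n : QPhi n != 0.
Proof.
by apply/monic_neq0/monic_map/Cyclotomic_monic.
Qed.

Lemma QPhi_irr n : irreducible_poly (QPhi n).
Proof.
have m_gt0 : (0 < maxn n 1)%N by rewrite leq_max orbT.
have [z prim_z] := C_prim_root_exists m_gt0.
have pz0 : root (map_poly ratr (QPhi n)) z.
  by rewrite map_QPhi; apply: root_Cyclotomic.
apply/(subfx_irreducibleP pz0 (QPhi_neq0 n)) => q qz0 nz_q.
have [p [Dp _] dv_p] := minCpolyP z.
have -> : QPhi n = p.
  apply: (map_inj_poly (fmorph_inj (ratr : {rmorphism rat -> algC}))).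
    exact: rmorph0.
  by rewrite -Dp (minCpoly_cyclotomic prim_z) map_QPhi (Cintr_Cyclotomic prim_z).
by apply: dvdp_leq => //; rewrite -dv_p.
Qed.

Definition Qomega_fieldExt n : fieldExtType rat :=
  SubFieldExtType (QPhi_root n) (QPhi_irr n).

Definition Qomega_root n : Qomega_fieldExt n :=
  subfx_root ratr (omega n) (QPhi n).

Lemma Qomega_splitting n : splitting_field_axiom (Qomega_fieldExt n).
Proof.
pose w := Qomega_root n; pose m := maxn n 1.
have prim_w : m.-primitive_root w.
  rewrite -(fmorph_primitive_root
    (subfx_inj : {rmorphism subFExtend ratr (omega n) (QPhi n) -> R[i]})).
  rewrite [_ w](subfx_inj_root (QPhi_root n) (QPhi_neq0 n)) -omega_max.
  by apply: omega_prim; rewrite leq_max orbT.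
exists ('X^m - 1); first by rewrite rpredB ?rpred1 // rpredX ?polyOverX.
exists [seq w ^+ i | i <- index_iota 0 m].
  by rewrite big_map (factor_Xn_sub_1 prim_w) eqpxx.
apply/vspaceP=> x; rewrite memvf.
have [q ->] := subfxEroot (QPhi_root n) (QPhi_neq0 n) x.
apply: rpred_horner; last first.
  have [m1 | m1] := leqP m 1.
    have -> : subfx_root ratr (omega n) (QPhi n) = 1 :> Qomega_fieldExt n.
      move: prim_w; have -> : m = 1%N by apply/eqP; rewrite eqn_leq m1 leq_max orbT.
      by move/prim_expr_order; rewrite expr1.
    exact: mem1v.
  apply: seqv_sub_adjoin; apply/mapP; exists 1%N; last by rewrite expr1.
  by rewrite mem_index_iota.
apply/polyOverP=> i; rewrite coef_map /=.
by apply: memvZ; apply: mem1v.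
Qed.

Definition Qomega n : splittingFieldType rat :=
  HB.pack (Qomega_fieldExt n)
    (FieldExt_isSplittingField.Build rat (Qomega_fieldExt n)
       (Qomega_splitting n)).

Definition Qomega_val n : {rmorphism Qomega n -> R[i]} :=
  subfx_inj (iota := ratr) (z := omega n) (p := QPhi n).

Lemma Qomega_valE n (x : Qomega n) :
  exists p : {poly rat}, Qomega_val n x = (map_poly ratr p).[omega n].
Proof.
have [q ->] := subfxE x; exists q.
exact: subfx_inj_eval (QPhi_root n) (QPhi_neq0 n) q.
Qed.

Lemma omega_val n : Qomega_val n (Qomega_root n : Qomega n) = omega n.
Proof. exact: subfx_inj_root (QPhi_root n) (QPhi_neq0 n). Qed.

Definition alpha (k n : nat) : R[i] := (cos (2 * pi * k%:R / n%:R))%:C.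

(* Compatible families start at index 1: F 0 is unconstrained, and cosine_eval
   does not involve it when n >= 2. *)
Definition compatible (F : forall n, {mpoly rat[n]}) : Prop :=
  forall n, (0 < n)%N ->
    F n = F n.+1 \mPo
      [tuple if unlift ord_max i is Some j then 'X_j else 0 | i < n.+1].

(* The index i : 'I_(n.-1) starts at 0, hence the shift. *)
Definition cosine_eval (F : forall n, {mpoly rat[n]}) (n : nat) : R[i] :=
  mmap (ratr : rat -> R[i]) (fun i : 'I_n.-1 => alpha i.+1 n) (F n.-1).

End RootsOfUnity.

Arguments Qomega_val R n : clear implicits.
Arguments Qomega_root R n : clear implicits.

(* v is the value at x of the rational function r, r being defined at x. *)
Definition ratfun_value (K : fieldType) (r : {fraction {poly K}}) (x v : K) :
    Prop :=
  exists p q : {poly K},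
    [/\ q.[x] != 0, r = FracField.tofrac p / FracField.tofrac q
      & v = p.[x] / q.[x]].

Definition summable_at_cosine_points (R : realType)
    (F : forall n, {mpoly rat[n]}) : Prop :=
  exists (N : nat) (r : {fraction {poly rat}}), (2 <= N)%N /\
    forall n, (N <= n)%N ->
      exists2 v : rat, ratfun_value r n%:R v & cosine_eval R F n = ratr v.

(* Includes the assertion that z lies in Q(omega_n), identified with its image
   in R[i] under Qomega_val. *)
Definition fixed_by_galois (R : realType) (n : nat) (z : R[i]) : Prop :=
  exists2 x : Qomega R n, Qomega_val R n x = z
    & forall g : gal_of {:Qomega R n},
        g \in 'Gal({:Qomega R n} / 1)%g -> g x = x.

Definition is_rational (R : realType) (z : R[i]) : Prop :=
  exists q : rat, z = ratr q.

(* Main.v *)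
Require Import Defs.
From mathcomp Require Import all_boot all_order all_algebra all_field.
From mathcomp Require Import complex reals trigo mpoly.

Set Implicit Arguments.
Unset Strict Implicit.
Unset Printing Implicit Defensive.

Import Order.TTheory GRing.Theory Num.Theory.
Local Open Scope ring_scope.

(** For large [n] summability equates the cosine value with a rational function over Q evaluated at
    an integer, hence with a rational number. Galois invariance is the same as rationality
    ([fixed_by_galoisP]): Q(omega_n) is a splitting field in characteristic zero, so it is Galois
    over Q and its fixed field is Q. *)

Lemma galois_over_rat (L : splittingFieldType rat) : galois 1 {:L}.
Proof.
rewrite /galois sub1v normalFieldf andbT /=.
apply/separableP=> x _; apply: pcharf0_separable => p.
by rewrite pchar_lalg; apply: pchar_num.
Qed.

(** A field morphism out of Q is unique. *)
Lemma Qomega_val_alg (R : realType) n (q : rat) :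
  Qomega_val R n (q%:A) = ratr q.
Proof. exact: (fmorph_eq_rat (Qomega_val R n \o in_alg (Qomega R n))). Qed.

Lemma fixed_by_galoisP (R : realType) n (z : R[i]) :
  fixed_by_galois n z <-> is_rational z.
Proof.
split=> [[x <- fix_x]|[q ->]].
  (* [1%VS] is the copy of Q in Q(omega_n), and the Galois correspondence makes it the fixed field
     of the whole group. *)
  suff /vlineP[q ->] : x \in 1%VS by exists q; apply: Qomega_val_alg.
  have /galois_fixedField <- := galois_over_rat (Qomega R n).
  by apply/fixedFieldP; rewrite ?memvf.
exists q%:A; first exact: Qomega_val_alg.
by move=> g g_gal; apply: (fixed_gal (sub1v _) g_gal); apply/rpredZ/mem1v.
Qed.

Theorem lemma2p5 (R : realType) (F : forall n : nat, {mpoly rat[n]}) :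
  compatible F -> summable_at_cosine_points R F ->
  (exists M : nat, (2 <= M)%N /\
     forall n : nat, (M <= n)%N ->
       fixed_by_galois n (cosine_eval R F n) /\
       is_rational (cosine_eval R F n)) /\
  (forall n : nat, (2 <= n)%N ->
     fixed_by_galois n (cosine_eval R F n) <->
     is_rational (cosine_eval R F n)).
Proof.
move=> _ [N [r [N_ge2 sumF]]]; split=> [|n _]; last exact: fixed_by_galoisP.
(* The summability threshold itself serves as [M]. *)
exists N; split=> // n /sumF[v _ ->].
have rat_v : is_rational (ratr v : R[i]) by exists v.
by split=> //; apply/fixed_by_galoisP.
Qed.
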